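(* Let $p$ be an odd prime and $r$ a positive integer. Then \[ \sum_{\substack{i+j+k=p^{r}\\ i,j,k\in \mathcal{P}_{p}}}\frac{(-1)^{i}}{ijk}\equiv \frac{1}{2}p^{r-1}B_{p-3} \pmod{p^{r}}. \]
   Context: $\mathcal{P}_{n}$ denotes the set of positive integers coprime to $n$; the sum runs over ordered triples of positive integers $(i,j,k)$, each coprime to $p$, with $i+j+k=p^r$. The Bernoulli numbers $B_k$ are defined by $B_0=1$ and $\sum_{i=0}^{n}\binom{n+1}{i}B_{i}=0$ for $n\geq 1$. Congruences between rational numbers whose denominators are coprime to $p$ are understood in the ring of $p$-integral rationals: $a\equiv b \pmod{p^s}$ means $(a-b)/p^s$ has denominator coprime to $p$. *)

(* Defs.v *)
From HB Require Import structures.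
From mathcomp Require Import all_boot all_order all_algebra.

Set Implicit Arguments.
Unset Strict Implicit.
Unset Printing Implicit Defensive.

Import Order.TTheory GRing.Theory Num.Theory.
Local Open Scope ring_scope.

Definition posCoprime (n : nat) : pred nat :=
  fun m => (0 < m)%N && coprime m n.

(* bernoulli_seq n = [:: B_0; ...; B_(n-1)], where the recurrence
   \sum_(i < n.+1) 'C(n.+1, i) * B_i = 0 (n >= 1) is solved for B_n, whose
   coefficient is n.+1; see bernoulli0 and bernoulli_rec. *)
Fixpoint bernoulli_seq (n : nat) : seq rat :=
  if n is m.+1 then
    let s := bernoulli_seq m in
    rcons s (if m == 0%N then 1
             else - (\sum_(i < m) 'C(m.+1, i)%:R * s`_i) / m.+1%:R)
  else [::].

Definition bernoulli (n : nat) : rat := (bernoulli_seq n.+1)`_n.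

Lemma size_bernoulli_seq n : size (bernoulli_seq n) = n.
Proof. by elim: n => //= n IHn; rewrite size_rcons IHn. Qed.

Lemma nth_bernoulli_seq n i :
  (i < n)%N -> (bernoulli_seq n)`_i = bernoulli i.
Proof.
elim: n => // n IHn; rewrite ltnS leq_eqVlt => /orP[/eqP-> // | lt_in].
by rewrite /= nth_rcons size_bernoulli_seq lt_in IHn.
Qed.

Lemma bernoulli0 : bernoulli 0 = 1.
Proof. by []. Qed.

Lemma bernoulli_rec n : (0 < n)%N ->
  \sum_(i < n.+1) 'C(n.+1, i)%:R * bernoulli i = 0.
Proof.
move=> n_gt0; rewrite big_ord_recr /= binSn.
rewrite {2}/bernoulli /= nth_rcons size_bernoulli_seq ltnn eqxx.
rewrite -[n == 0]negbK -lt0n n_gt0 /= mulrC divfK ?pnatr_eq0 //.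
under [X in _ - X]eq_bigr => i _ do rewrite nth_bernoulli_seq //.
by rewrite subrr.
Qed.

(* a = b mod p^s in the ring of p-integral rationals.  denq is the (positive)
   denominator in lowest terms. *)
Definition pint_eqmod (p s : nat) (a b : rat) : Prop :=
  coprime `|denq ((a - b) / (p ^ s)%N%:R)|%N p.

(* Main.v *)
Require Import Defs.
From HB Require Import structures.
From mathcomp Require Import all_boot all_order all_algebra.
From mathcomp Require Import ring zify.
Import Order.TTheory GRing.Theory Num.Theory.
Local Open Scope ring_scope.

(** Put q = p^r and work modulo q.  Eliminating k and using the partial fraction
    1/(j(i+j)) = (1/j - 1/(i+j))/i together with the reflections j -> q - j and
    (i, m) -> (q - i, q - m), the triple sum becomes the sum of (-1)^i/(i^2 m)
    over all i, m < q with i, m and i - m coprime to p.  As the sum of all 1/m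
    vanishes modulo q, only minus the sum over the pairs with i = m mod p remains.
    The sum of 1/m over the class of c is p^(r-1)/c modulo p^r, which reduces the
    statement to - sum_{0<c<p} (-1)^c/c^3 = B_{p-3}/2 modulo p.  There, 1/c^3 is
    c^(p-4), and power sums over even integers are evaluated with the umbral form
    L(X^n) = B_n, which satisfies L(f(X+1)) = L(f) + f'(0) and
    L(f(2X+1)) + L(f(2X)) = 2 L(f). *)

(** * Congruences in the ring of p-integral rationals *)

Definition pintegral (p : nat) : {pred rat} :=
  fun x => coprime `|denq x|%N p.

(** Any denominator coprime to p will do, since the reduced one divides it; closure under ring
    operations then only needs products of denominators. *)
Lemma pintegralP (p : nat) (x : rat) :
  reflect (exists (d : nat) (n : int), coprime d p /\ x * d%:R = n%:~R)
          (x \in pintegral p).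
Proof.
apply: (iffP idP) => [px | [d [n [dp xd]]]].
  exists `|denq x|%N, (numq x); split=> //.
  by rewrite numqE -[denq x in RHS]absz_denq.
rewrite -topredE /= /pintegral; apply: coprime_dvdl dp.
have E : numq x * d = n * denq x.
  by apply: (@intr_inj rat); rewrite !intrM -xd numqE; ring.
rewrite -(@Gauss_dvdr _ `|numq x|%N); last first.
  by rewrite coprime_sym coprime_num_den.
by have /(congr1 absz) := E; rewrite !abszM /= => ->; apply: dvdn_mull.
Qed.

Lemma pintegral_subring (p : nat) : subring_closed (pintegral p).
Proof.
split=> [|x y|x y].
- by apply/pintegralP; exists 1%N, 1; split; rewrite ?coprime1n ?mulr1.
- move=> /pintegralP[d [n [dp xd]]] /pintegralP[e [m [ep ye]]].
  apply/pintegralP; exists (d * e)%N, (n * e%:Z - m * d%:Z).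
  by rewrite coprimeMl dp ep natrM rmorphB /= !rmorphM /= -xd -ye /=; split=> //; ring.
- move=> /pintegralP[d [n [dp xd]]] /pintegralP[e [m [ep ye]]].
  apply/pintegralP; exists (d * e)%N, (n * m).
  by rewrite coprimeMl dp ep natrM !rmorphM /= -xd -ye /=; split=> //; ring.
Qed.

HB.instance Definition _ (p : nat) :=
  GRing.isSubringClosed.Build rat (pintegral p) (pintegral_subring p).

Lemma pintegralV (p n : nat) : coprime n p -> (n%:R)^-1 \in pintegral p.
Proof.
move=> np; apply/pintegralP; exists n; case: n np => [|n] np.
  by exists 0; rewrite mulr0.
by exists 1; rewrite mulVf ?pnatr_eq0.
Qed.

Lemma pint_eqmodE (p s : nat) (a b : rat) :
  pint_eqmod p s a b <-> (a - b) / p%:R ^+ s \in pintegral p.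
Proof. by rewrite /pint_eqmod natrX. Qed.

Lemma pint_eqmod_ref (p s : nat) (a : rat) : pint_eqmod p s a a.
Proof. by apply/pint_eqmodE; rewrite subrr mul0r rpred0. Qed.

Lemma pint_eqmod_sym (p s : nat) (a b : rat) :
  pint_eqmod p s a b -> pint_eqmod p s b a.
Proof. by move=> /pint_eqmodE h; apply/pint_eqmodE; rewrite -rpredN -mulNr opprB. Qed.

Lemma pint_eqmod_trans (p s : nat) (b a c : rat) :
  pint_eqmod p s a b -> pint_eqmod p s b c -> pint_eqmod p s a c.
Proof.
move=> /pint_eqmodE h /pint_eqmodE k; apply/pint_eqmodE.
by rewrite -(subrKA b) mulrDl rpredD.
Qed.

Lemma pint_eqmodD (p s : nat) (a b c d : rat) :
  pint_eqmod p s a b -> pint_eqmod p s c d -> pint_eqmod p s (a + c) (b + d).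
Proof.
move=> /pint_eqmodE h /pint_eqmodE k; apply/pint_eqmodE.
by rewrite opprD addrACA mulrDl rpredD.
Qed.

Lemma pint_eqmodN (p s : nat) (a b : rat) :
  pint_eqmod p s a b -> pint_eqmod p s (- a) (- b).
Proof.
by move=> /pint_eqmodE h; apply/pint_eqmodE; rewrite -opprD mulNr rpredN.
Qed.

Lemma pint_eqmodB (p s : nat) (a b c d : rat) :
  pint_eqmod p s a b -> pint_eqmod p s c d -> pint_eqmod p s (a - c) (b - d).
Proof. by move=> h k; apply: pint_eqmodD => //; apply: pint_eqmodN. Qed.

Lemma pint_eqmod_sum (p s : nat) (I : Type) (r : seq I) (P : pred I)
    (F G : I -> rat) :
  (forall i, P i -> pint_eqmod p s (F i) (G i)) ->
  pint_eqmod p s (\sum_(i <- r | P i) F i) (\sum_(i <- r | P i) G i).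
Proof.
move=> h; elim/big_rec2: _ => [|i x y Pi k]; first exact: pint_eqmod_ref.
by apply: pint_eqmodD => //; apply: h.
Qed.

Lemma pint_eqmod_sum_nat (p s m n : nat) (F G : nat -> rat) :
  (forall i, (m <= i < n)%N -> pint_eqmod p s (F i) (G i)) ->
  pint_eqmod p s (\sum_(m <= i < n) F i) (\sum_(m <= i < n) G i).
Proof. by move=> h; rewrite !big_nat; apply: pint_eqmod_sum. Qed.

Lemma pint_eqmodMl (p s : nat) (c a b : rat) : c \in pintegral p ->
  pint_eqmod p s a b -> pint_eqmod p s (c * a) (c * b).
Proof.
by move=> pc /pint_eqmodE h; apply/pint_eqmodE; rewrite -mulrBr -mulrA rpredM.
Qed.

Lemma pint_eqmodMr (p s : nat) (c a b : rat) : c \in pintegral p ->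
  pint_eqmod p s a b -> pint_eqmod p s (a * c) (b * c).
Proof. by rewrite ![_ * c]mulrC; apply: pint_eqmodMl. Qed.

Lemma pint_eqmodM (p s : nat) (a b c d : rat) :
  a \in pintegral p -> d \in pintegral p ->
  pint_eqmod p s a b -> pint_eqmod p s c d -> pint_eqmod p s (a * c) (b * d).
Proof.
move=> pa pd h k; apply: (@pint_eqmod_trans _ _ (a * d)).
  exact: pint_eqmodMl.
exact: pint_eqmodMr.
Qed.

Lemma pint_eqmodX (p s n : nat) (a b : rat) :
  a \in pintegral p -> b \in pintegral p ->
  pint_eqmod p s a b -> pint_eqmod p s (a ^+ n) (b ^+ n).
Proof.
move=> pa pb h; elim: n => [|n IHn]; first by rewrite !expr0; apply: pint_eqmod_ref.
by rewrite !exprS; apply: pint_eqmodM; rewrite ?rpredX.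
Qed.

(** This lets a factor p^(r-1) lift a congruence modulo p to one modulo p^r. *)
Lemma pint_eqmodMpX (p s t : nat) (a b : rat) : (0 < p)%N ->
  pint_eqmod p s a b ->
  pint_eqmod p (t + s) (p%:R ^+ t * a) (p%:R ^+ t * b).
Proof.
move=> p_gt0 /pint_eqmodE h; apply/pint_eqmodE.
by rewrite -mulrBr exprD -mulf_div divff ?mul1r // expf_neq0 // pnatr_eq0 -lt0n.
Qed.

Lemma pint_eqmod_weak (p s t : nat) (a b : rat) : (0 < p)%N -> (t <= s)%N ->
  pint_eqmod p s a b -> pint_eqmod p t a b.
Proof.
move=> p_gt0 ts /pint_eqmodE h; apply/pint_eqmodE.
have p0 : (p%:R : rat) != 0 by rewrite pnatr_eq0 -lt0n.
rewrite (_ : _ / _ = (a - b) / p%:R ^+ s * p%:R ^+ (s - t)).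
  by rewrite rpredM // rpredX // rpred_nat.
by rewrite -{1}(subnKC ts) exprD; field; rewrite !expf_neq0.
Qed.

Lemma pint_eqmod_half (p s : nat) (a b : rat) : odd p ->
  pint_eqmod p s (2 * a) (2 * b) -> pint_eqmod p s a b.
Proof.
move=> p_odd h.
have := pint_eqmodMl p s 2^-1 _ _ _ h.
by rewrite !mulKf //; apply; rewrite (pintegralV p 2) // coprime2n.
Qed.

Lemma pint_eqmod_add_mul (p s : nat) (a c : rat) : (0 < p)%N ->
  c \in pintegral p -> pint_eqmod p s (a + p%:R ^+ s * c) a.
Proof.
move=> p_gt0 pc; apply/pint_eqmodE.
by rewrite addrC addKr mulrC mulKf // expf_neq0 // pnatr_eq0 -lt0n.
Qed.

(** * The umbral form of the Bernoulli numbers *)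

Definition umbral (f : {poly rat}) : rat := \sum_(i < size f) f`_i * bernoulli i.

Lemma umbral_widen (n : nat) (f : {poly rat}) : (size f <= n)%N ->
  umbral f = \sum_(i < n) f`_i * bernoulli i.
Proof.
move=> fn; rewrite /umbral (big_ord_widen n (fun i => f`_i * bernoulli i)) //.
rewrite big_mkcond; apply: eq_bigr => i _; case: ltnP => // h.
by rewrite nth_default ?mul0r.
Qed.

Lemma umbral_is_linear : scalar umbral.
Proof.
move=> a f g.
have sf : (size f <= maxn (size f) (size g))%N by rewrite leq_maxl.
have sg : (size g <= maxn (size f) (size g))%N by rewrite leq_maxr.
have sfg : (size (a *: f + g)%R <= maxn (size f) (size g))%N.
  by rewrite (leq_trans (size_polyD _ _)) // geq_max sg (leq_trans (size_scale_leq _ _)).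
rewrite (umbral_widen _ _ sf) (umbral_widen _ _ sg) (umbral_widen _ _ sfg).
rewrite mulr_sumr -big_split; apply: eq_bigr => i _ /=.
by rewrite coefD coefZ; ring.
Qed.

HB.instance Definition _ :=
  GRing.isLinear.Build rat {poly rat} rat *%R umbral umbral_is_linear.

Lemma umbralXn (n : nat) : umbral 'X^n = bernoulli n.
Proof.
rewrite /umbral size_polyXn big_ord_recr /= coefXn eqxx mul1r big1 ?add0r // => i _.
by rewrite coefXn ltn_eqF // mul0r.
Qed.

(** In the binomial expansion the terms below n cancel by the Bernoulli recurrence once n >= 2; for
    n = 1 they leave B_0 = 1. *)
Lemma umbral_shiftXn (n : nat) :
  umbral (('X + 1) ^+ n) = bernoulli n + (n == 1%N)%:R.
Proof.
rewrite addrC exprDn raddf_sum big_ord_recr /= subnn expr0 mul1r binn.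
rewrite umbralXn addrC; congr (_ + _).
under eq_bigr => i _ do rewrite expr1n mul1r raddfMn /= umbralXn -mulr_natl.
case: n => [|[|n]]; first by rewrite big_ord0.
  by rewrite big_ord1 bin0 bernoulli0 mulr1.
exact: bernoulli_rec.
Qed.

Lemma umbral_shift (f : {poly rat}) :
  umbral (f \Po ('X + 1)) = umbral f + f^`().[0].
Proof.
rewrite -[f]coefK poly_def !raddf_sum /= horner_sum -big_split /=.
apply: eq_bigr => i _.
rewrite linearZ /= comp_Xn_poly !linearZ /= umbral_shiftXn umbralXn.
rewrite hornerZ derivXn -mulrDr; congr (_ * (_ + _)).
by case: (i : nat) => [|[|n]]; rewrite ?hornerMn ?hornerXn ?mulr0n ?horner0 ?expr0 // expr0n /= mul0rn.
Qed.

Lemma umbral_affine_shift (a b : rat) (f : {poly rat}) :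
  umbral (f \Po (a *: 'X + (a + b)%:P)) =
  umbral (f \Po (a *: 'X + b%:P)) + a * f^`().[b].
Proof.
have -> : f \Po (a *: 'X + (a + b)%:P) = (f \Po (a *: 'X + b%:P)) \Po ('X + 1).
  rewrite -comp_polyA; congr (_ \Po _).
  by rewrite comp_polyD comp_polyZ comp_polyX comp_polyC scalerDr alg_polyC polyCD addrA.
rewrite umbral_shift deriv_comp derivD derivC addr0 derivZ derivX hornerM.
by rewrite horner_comp !hornerE /= mulr1 [a * _]mulrC.
Qed.

(** A Faulhaber formula along an arithmetic progression: each unit shift of X contributes one value
    of a f', and the sum telescopes. *)
Lemma umbral_sum_deriv (a b : rat) (f : {poly rat}) (N : nat) :
  a * \sum_(0 <= c < N) f^`().[a * c%:R + b] =
  umbral (f \Po (a *: 'X + (a * N%:R + b)%:P)) - umbral (f \Po (a *: 'X + b%:P)).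
Proof.
pose u c := umbral (f \Po (a *: 'X + (a * c%:R + b)%:P)).
have -> : umbral (f \Po (a *: 'X + b%:P)) = u 0%N by rewrite /u mulr0 add0r.
rewrite -/(u N) mulr_sumr; apply: telescope_sumr_eq => // c _.
by rewrite /u -natr1 mulrDr mulr1 addrAC [_ + a]addrC umbral_affine_shift; ring.
Qed.

(** Its vanishing is the duplication formula for Bernoulli polynomials at 0. The constant [0%:P]
    gives both halves the shape of [umbral_affine_shift]. *)
Definition dup_defect (f : {poly rat}) : rat :=
  umbral (f \Po (2 *: 'X + 1%:P)) + umbral (f \Po (2 *: 'X + 0%:P))
  - 2 * umbral f.

Lemma dup_defect_is_linear : scalar dup_defect.
Proof.
by move=> a f g; rewrite /dup_defect !(linearP, comp_polyD, comp_polyZ) /=; ring.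
Qed.

HB.instance Definition _ :=
  GRing.isLinear.Build rat {poly rat} rat *%R dup_defect dup_defect_is_linear.

(** The shift turns f(2X) into f(2X+1) and f(2X+1) into f(2X+2); the latter gains 2f'(0), which
    cancels the gain of 2 L(f). *)
Lemma dup_defect_shift (f : {poly rat}) :
  dup_defect (f \Po ('X + 1)) = dup_defect f.
Proof.
rewrite /dup_defect umbral_shift -!comp_polyA.
rewrite !(comp_polyD, comp_polyX, comp_polyC) -!addrA -!polyCD -/(2 : rat) addr0.
have := umbral_affine_shift 2 0 f; rewrite addr0 => ->; rewrite add0r !addr0; ring.
Qed.

(* A linear form that is invariant under translation by 1 kills every difference
   [f (X + 1) - f X], hence every polynomial. *)
Lemma dup_defectXn (n : nat) : dup_defect 'X^n = 0.
Proof.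
elim/ltn_ind: n => n IHn.
(* (X+1)^(n+1) - X^(n+1) is (n+1)X^n plus lower terms, which the induction hypothesis removes. *)
have /eqP := dup_defect_shift 'X^(n.+1); rewrite comp_Xn_poly -subr_eq0 -raddfB.
rewrite [('X + 1) ^+ _](_ : _ = 'X^(n.+1) + \sum_(i < n.+1) 'X^i *+ 'C(n.+1, i)).
  rewrite addrAC subrr add0r raddf_sum big_ord_recr /= binSn raddfMn /= big1 => [|i _].
    by rewrite add0r -mulr_natr mulf_eq0 pnatr_eq0 orbF => /eqP.
  by rewrite raddfMn /= IHn ?mul0rn.
rewrite addrC exprDn big_ord_recr /= subnn mul1r binn addrC; congr (_ + _).
by apply: eq_bigr => i _; rewrite expr1n mul1r.
Qed.

Lemma umbral_duplication (n : nat) :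
  umbral ((2 *: 'X + 1) ^+ n) + umbral ((2 *: 'X) ^+ n) = 2 * bernoulli n.
Proof.
have /eqP := dup_defectXn n.
by rewrite /dup_defect !comp_Xn_poly addr0 umbralXn subr_eq0 => /eqP.
Qed.

(** * p-integrality of Bernoulli numbers and umbral values *)

(** Solving the recurrence for B_n divides only by n+1, which is prime to p in this range. *)
Lemma bernoulli_pintegral (p n : nat) : prime p -> (n.+1 < p)%N ->
  bernoulli n \in pintegral p.
Proof.
move=> p_prime; elim/ltn_ind: n => -[|n] IHn n_lt; first by rewrite bernoulli0 rpred1.
have := @bernoulli_rec n.+1 isT; rewrite big_ord_recr /= binSn => /eqP.
rewrite addrC addr_eq0 => /eqP E.
have -> : bernoulli n.+1 = (n.+2%:R)^-1 * (n.+2%:R * bernoulli n.+1).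
  by rewrite mulKf // pnatr_eq0.
rewrite E rpredM ?rpredN ?rpred_sum // => [|i _].
  by rewrite pintegralV // coprime_sym prime_coprime // gtnNdvd.
by rewrite rpredM ?rpred_nat // IHn // (leq_ltn_trans _ n_lt) // ltnS ltnW.
Qed.

Lemma umbral_affineE (n : nat) (a b : rat) :
  umbral ((a *: 'X + b%:P) ^+ n) =
  \sum_(i < n.+1) 'C(n, i)%:R * (b ^+ (n - i) * (a ^+ i * bernoulli i)).
Proof.
rewrite addrC exprDn raddf_sum; apply: eq_bigr => i _ /=.
rewrite raddfMn /= -polyC_exp mul_polyC exprZn !linearZ /= umbralXn.
by rewrite mulr_natl.
Qed.

(** The value is a polynomial in b with p-integral coefficients, as only B_i with i <= n occur. *)
Lemma umbral_affine_eqmod (p s n : nat) (a b c : rat) :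
  prime p -> (n.+1 < p)%N ->
  a \in pintegral p -> b \in pintegral p -> c \in pintegral p ->
  pint_eqmod p s b c ->
  pint_eqmod p s (umbral ((a *: 'X + b%:P) ^+ n)) (umbral ((a *: 'X + c%:P) ^+ n)).
Proof.
move=> p_prime n_lt pa pb pc bc; rewrite !umbral_affineE.
apply: pint_eqmod_sum => i _; apply: pint_eqmodMl; first by rewrite rpred_nat.
apply: pint_eqmodMr; last exact: pint_eqmodX.
rewrite rpredM ?rpredX // bernoulli_pintegral //.
by rewrite (leq_ltn_trans _ n_lt) // ltn_ord.
Qed.

(** * Inverses modulo powers of p *)

Lemma prime_coprime_gt0 (p c : nat) : prime p -> coprime c p -> (0 < c)%N.
Proof.
by case: c => // p_prime /eqP; rewrite gcd0n => pE; rewrite pE in p_prime.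
Qed.

(* Extending the inverse by 0 to the multiples of [p] turns sums restricted to
   integers coprime to [p] into plain sums. *)
Definition pinv (p i : nat) : rat := if coprime i p then (i%:R)^-1 else 0.

Lemma pinv_pintegral (p i : nat) : pinv p i \in pintegral p.
Proof. by rewrite /pinv; case: ifP => h; rewrite ?rpred0 ?pintegralV. Qed.

Lemma pinv0 (p : nat) : pinv p 0 = 0.
Proof. by rewrite /pinv invr0 if_same. Qed.

Lemma pinv_addM (p s i k : nat) : prime p -> (0 < s)%N ->
  pint_eqmod p s (pinv p (i + p ^ s * k)) (pinv p i).
Proof.
move=> p_prime s_gt0.
have co : coprime (i + p ^ s * k) p = coprime i p.
  rewrite ![coprime _ p]coprime_sym !prime_coprime // dvdn_addl //.
  by rewrite dvdn_mulr // dvdn_exp.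
rewrite /pinv co; case: ifP => // ip; last exact: pint_eqmod_ref.
have i0 : i%:R != 0 :> rat by rewrite pnatr_eq0 -lt0n (prime_coprime_gt0 p).
have j0 : (i + p ^ s * k)%:R != 0 :> rat.
  by rewrite pnatr_eq0 -lt0n (prime_coprime_gt0 p) ?co.
have -> : ((i + p ^ s * k)%:R)^-1
    = i%:R^-1 + p%:R ^+ s * (- k%:R * ((i + p ^ s * k)%:R^-1 * i%:R^-1)) :> rat.
  by move: j0; rewrite natrD natrM natrX => j0; field; rewrite i0 j0.
apply: pint_eqmod_add_mul; first exact: prime_gt0.
by rewrite !rpredM ?rpredN ?rpred_nat ?pintegralV ?co.
Qed.

Lemma pinv_opp (p r i : nat) : prime p -> (0 < r)%N -> (i <= p ^ r)%N ->
  pint_eqmod p r (pinv p (p ^ r - i)) (- pinv p i).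
Proof.
move=> p_prime r_gt0 ilt.
have co : coprime (p ^ r - i) p = coprime i p.
  rewrite ![coprime _ p]coprime_sym !prime_coprime // dvdn_subr //.
  by rewrite dvdn_exp.
rewrite /pinv co; case: ifP => // ip; last by rewrite oppr0; exact: pint_eqmod_ref.
have i0 : i%:R != 0 :> rat by rewrite pnatr_eq0 -lt0n (prime_coprime_gt0 p).
have j0 : (p ^ r - i)%:R != 0 :> rat.
  by rewrite pnatr_eq0 -lt0n (prime_coprime_gt0 p) ?co.
have -> : ((p ^ r - i)%:R)^-1
    = - i%:R^-1 + p%:R ^+ r * ((p ^ r - i)%:R^-1 * i%:R^-1) :> rat.
  by move: j0; rewrite natrB // natrX => j0; field; rewrite i0 j0.
by apply: pint_eqmod_add_mul; rewrite ?prime_gt0 // rpredM ?pintegralV ?co.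
Qed.

(** The reflection i -> p^r - i negates odd powers, so twice the sum vanishes, and 2 is
    invertible. *)
Lemma sum_pinv_odd (p r n : nat) : prime p -> odd p -> (0 < r)%N -> odd n ->
  pint_eqmod p r (\sum_(1 <= i < p ^ r) pinv p i ^+ n) 0.
Proof.
move=> p_prime p_odd r_gt0 n_odd; apply: pint_eqmod_half => //.
rewrite mulr0 mulr_natl mulr2n {2}big_nat_rev -big_split /=.
rewrite [X in pint_eqmod _ _ _ X](_ : 0 = \sum_(1 <= i < p ^ r) 0); last by rewrite big1.
apply: pint_eqmod_sum_nat => i /andP[_ ilt]; rewrite add1n subSS.
rewrite -(subrr (pinv p i ^+ n)); apply: pint_eqmodD; first exact: pint_eqmod_ref.
have -> : - pinv p i ^+ n = (- pinv p i) ^+ n.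
  by rewrite [RHS]exprNn -signr_odd n_odd mulN1r.
apply: pint_eqmodX; rewrite ?rpredN ?pinv_pintegral //.
by apply: pinv_opp => //; apply: ltnW.
Qed.

(** * The alternating sum of inverse cubes modulo p *)

Lemma expr_pred_eqmod1 (p c : nat) : prime p -> coprime c p ->
  pint_eqmod p 1 (c%:R ^+ p.-1) 1.
Proof.
move=> p_prime cp.
have c0 := prime_coprime_gt0 p c p_prime cp.
have : (p %| c ^ p.-1 - 1)%N.
  rewrite -(@Gauss_dvdr _ c) 1?coprime_sym // mulnBr muln1 -expnS prednK ?prime_gt0 //.
  have /eqP := @fermat_little c p p_prime; rewrite eqn_mod_dvd //.
  by rewrite -{1}(expn1 c) leq_pexp2l // prime_gt0.
move=> /dvdnP[k E].
have -> : c%:R ^+ p.-1 = 1 + p%:R ^+ 1 * k%:R :> rat.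
  by rewrite expr1 -natrM mulnC -E -natrX natrB ?expn_gt0 ?c0 // addrC subrK.
by apply: pint_eqmod_add_mul; rewrite ?prime_gt0 ?rpred_nat.
Qed.

(** Fermat gives 1/c^3 = c^(p-1)/c^3. Multiples of p agree too, because p > 4 makes the exponent p-4
    positive. *)
Lemma pinv_cube_eqmod (p c : nat) : prime p -> (4 < p)%N ->
  pint_eqmod p 1 (pinv p c ^+ 3) (c%:R ^+ (p - 4)).
Proof.
move=> p_prime p_gt4; rewrite /pinv; case: ifP => cp; last first.
  have pc : (p %| c)%N.
    by apply: contraFT cp => h; rewrite coprime_sym prime_coprime.
  case/dvdnP: pc => k ->; have -> : (p - 4 = (p - 5).+1)%N by lia.
  rewrite expr0n /= natrM mulrC exprS -mulrA -[X in pint_eqmod _ _ _ X]add0r.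
  apply: pint_eqmod_sym; rewrite -[p%:R in X in pint_eqmod _ _ X]expr1.
  by apply: pint_eqmod_add_mul; rewrite ?prime_gt0 // !(rpredM, rpredX) ?rpred_nat.
have c0 : c%:R != 0 :> rat.
  by rewrite pnatr_eq0 -lt0n (prime_coprime_gt0 p).
have -> : c%:R ^+ (p - 4) = (c%:R^-1) ^+ 3 * c%:R ^+ p.-1 :> rat.
  by rewrite (_ : p.-1 = 3 + (p - 4))%N; [rewrite exprD exprVn mulKf ?expf_neq0 | lia].
rewrite -[X in pint_eqmod _ _ X]mulr1.
apply: pint_eqmodMl; first by rewrite rpredX ?pintegralV.
by apply: pint_eqmod_sym; apply: expr_pred_eqmod1.
Qed.

(** The sign (-1)^c is twice the indicator of even c, minus 1. *)
Lemma sum_alternating (g : nat -> rat) (k : nat) :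
  \sum_(0 <= c < k.*2.+1) (-1) ^+ c * g c =
  2 * (\sum_(0 <= c < k.+1) g c.*2) - \sum_(0 <= c < k.*2.+1) g c.
Proof.
elim: k => [|k IHk]; first by rewrite !big_nat1 expr0; ring.
have split2 (F : nat -> rat) : \sum_(0 <= c < k.*2.+3) F c =
    \sum_(0 <= c < k.*2.+1) F c + F k.*2.+1 + F k.*2.+2.
  by rewrite 2?[\sum_(0 <= c < _.+2) _]big_nat_recr.
rewrite doubleS !split2 IHk [\sum_(0 <= c < k.+2) _]big_nat_recr //= doubleS.
by rewrite !exprS -signr_odd odd_double; ring.
Qed.

(** With B = B_{p-3}, t = 2^(p-3) and Z the sum of (2c)^(p-4), the derivative formula for X^(p-3)
    and duplication give -6Z = 2B - 2tB modulo p. As 4t = 1 modulo p, Z = -B/4. *)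
Lemma sum_pinv_cube_even (p : nat) : prime p -> odd p -> (4 < p)%N ->
  pint_eqmod p 1 (\sum_(0 <= c < p./2.+1) pinv p c.*2 ^+ 3)
             (- (1 / 4) * bernoulli (p - 3)).
Proof.
move=> p_prime p_odd p_gt4.
pose Z : rat := \sum_(0 <= c < p./2.+1) c.*2%:R ^+ (p - 4).
apply: (@pint_eqmod_trans _ _ Z).
  by apply: pint_eqmod_sum_nat => c _; apply: pinv_cube_eqmod.
have p_gt0 : (0 < p)%N by lia.
have co n : (0 < n < p)%N -> coprime n p.
  by case/andP=> n0 np; rewrite coprime_sym prime_coprime // gtnNdvd.
have pB : bernoulli (p - 3) \in pintegral p by apply: bernoulli_pintegral => //; lia.
have pZ : Z \in pintegral p by rewrite rpred_sum // => c _; rewrite rpredX ?rpred_nat.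
have pn : (p - 3)%:R = p%:R - 3 :> rat by rewrite natrB //; lia.
(* The evens 2c with c <= (p-1)/2 are those below p; the upper end of the telescope is p+1, which is
   1 modulo p. *)
have := umbral_sum_deriv 2 0 'X^(p - 3) p./2.+1.
rewrite !comp_Xn_poly !addr0 -natrM mul2n (_ : p./2.+1.*2 = p.+1)%N; last by lia.
have -> : \sum_(0 <= c < p./2.+1) ('X^(p - 3))^`().[2 * c%:R + 0 : rat] = (p%:R - 3) * Z.
  rewrite mulr_sumr; apply: eq_bigr => c _.
  rewrite derivXn hornerMn hornerXn -mulr_natl addr0 -natrM mul2n pn.
  by congr (_ * _ ^+ _); lia.
have := umbral_duplication (p - 3).
rewrite !exprZn !linearZ /= umbralXn => dup E.
have pB2 : pint_eqmod p 1 (2%:R ^+ p.-1) 1.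
  by apply: expr_pred_eqmod1; rewrite // coprime2n.
have h1 : pint_eqmod p 1 (umbral ((2 *: 'X + p.+1%:R%:P) ^+ (p - 3)))
            (umbral ((2 *: 'X + 1%:P) ^+ (p - 3))).
  apply: umbral_affine_eqmod; rewrite ?rpred_nat ?rpred1 //; first by lia.
  rewrite -natr1 addrC -[p%:R]mulr1 -[p%:R]expr1.
  by apply: pint_eqmod_add_mul; rewrite ?rpred1.
move/pint_eqmodE: h1; move/pint_eqmodE: pB2; rewrite expr1 => hp2 h1.
rewrite (_ : p.-1 = (p - 3) + 2)%N ?exprD in hp2; last by lia.
apply/pint_eqmodE; rewrite expr1.
set u1 := umbral _ in E h1; set u2 := umbral _ in h1 dup.
set t := 2 ^+ (p - 3) in E dup hp2; set B := bernoulli _ in E dup pB *.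
have p0 : p%:R != 0 :> rat by rewrite pnatr_eq0 -lt0n.
(* An exact identity exhibiting p-integrality: both inner quotients are p-integral by [h1] and
   [hp2], and 12 is prime to p. *)
have -> : (Z - - (1 / 4) * B) / p%:R
   = 12%:R^-1 * (4 * Z - 2 * ((u1 - u2) / p%:R) + ((t * 2 ^+ 2 - 1) / p%:R) * B).
  have -> : u1 = 2 * ((p%:R - 3) * Z) + t * B by rewrite E subrK.
  have -> : u2 = 2 * B - t * B by rewrite -dup addrK.
  by field.
rewrite rpredM //.
  by rewrite pintegralV // (coprimeMl p 3 4); rewrite (coprimeMl p 2 2) !co //; lia.
by apply: rpredD; [apply: rpredB; apply: rpredM; rewrite ?rpred_nat | apply: rpredM].
Qed.

Lemma sum_alternating_pinv_cube (p : nat) : prime p -> odd p ->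
  pint_eqmod p 1 (\sum_(0 <= c < p) (-1) ^+ c * pinv p c ^+ 3)
             (- (1 / 2) * bernoulli (p - 3)).
Proof.
move=> p_prime p_odd.
have [->|p_neq3] := eqVneq p 3%N.
  (* For p = 3 direct evaluation gives -7/8 against -1/2, which differ by -3/8. *)
  by rewrite unlock /pint_eqmod.
have p_gt4 : (4 < p)%N by move: p_prime p_odd p_neq3; case: p => [|[|[|[|[|]]]]].
have pE : p = p./2.*2.+1 by lia.
have := sum_alternating (fun c => pinv p c ^+ 3) p./2; rewrite -pE => ->.
(* Twice the even part minus the full sum; the latter vanishes modulo p because 3 is odd. *)
apply: (@pint_eqmod_trans _ _ (2 * (- (1 / 4) * bernoulli (p - 3)) - 0)).
  apply: pint_eqmodB.
    by apply: pint_eqmodMl; rewrite ?rpred_nat //; apply: sum_pinv_cube_even.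
  rewrite big_ltn ?prime_gt0 // pinv0 expr0n /= add0r.
  by have := sum_pinv_odd p 1 3 p_prime p_odd isT isT; rewrite expn1.
by rewrite (_ : 2 * _ - 0 = - (1 / 2) * bernoulli (p - 3)); [apply: pint_eqmod_ref | field].
Qed.

(** * Sums of inverses over residue classes *)

Lemma sum_nat_mul (n k : nat) (F : nat -> rat) :
  \sum_(0 <= i < n * k) F i = \sum_(0 <= i < n) \sum_(0 <= j < k) F (i * k + j)%N.
Proof.
rewrite big_nat_mul; apply: eq_bigr => i _.
rewrite -{1}(add0n (i * k)%N) big_addn mulSn addnK.
by apply: eq_bigr => j _; rewrite addnC.
Qed.

Lemma sum_nat_delta (n c : nat) (F : nat -> rat) : (c < n)%N ->
  \sum_(0 <= j < n) (if c == j then F j else 0) = F c.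
Proof.
by move=> cn; rewrite -big_mkcond big_mkord (big_pred1 (Ordinal cn)).
Qed.

(** Expand 1/(a + p^s v) to first order in p^s. The error is divisible by p^(2s), and 2s >= s+1; the
    linear terms add up to a multiple of p^s 'C(p, 2), and p divides 'C(p, 2) for odd p. *)
Lemma sum_pinv_lift (p s a : nat) : prime p -> odd p -> (0 < s)%N ->
  pint_eqmod p s.+1 (\sum_(0 <= v < p) pinv p (a + p ^ s * v)) (p%:R * pinv p a).
Proof.
move=> p_prime p_odd s_gt0.
have co v : coprime (a + p ^ s * v) p = coprime a p.
  rewrite ![coprime _ p]coprime_sym !prime_coprime // dvdn_addl //.
  by rewrite dvdn_mulr // dvdn_exp.
rewrite /pinv; case: ifP => // ap; last first.
  by rewrite big1 => [|v _]; rewrite ?co ?ap // mulr0; apply: pint_eqmod_ref.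
have a0 : a%:R != 0 :> rat by rewrite pnatr_eq0 -lt0n (prime_coprime_gt0 p).
have b0 v : (a + p ^ s * v)%:R != 0 :> rat.
  by rewrite pnatr_eq0 -lt0n (prime_coprime_gt0 p) ?co.
apply: (@pint_eqmod_trans _ _
          (\sum_(0 <= v < p) (a%:R^-1 - p%:R ^+ s * (a%:R^-1 ^+ 2 * v%:R)))).
  apply: pint_eqmod_sum_nat => v _; rewrite co ap.
  apply: (@pint_eqmod_weak _ (s + s)); [exact: prime_gt0 | by lia |].
  have -> : (a + p ^ s * v)%:R^-1 = a%:R^-1 - p%:R ^+ s * (a%:R^-1 ^+ 2 * v%:R)
      + p%:R ^+ (s + s) * (v%:R ^+ 2 * a%:R^-1 ^+ 2 * (a + p ^ s * v)%:R^-1) :> rat.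
    by move: (b0 v); rewrite natrD natrM natrX exprD => j0; field; rewrite a0 j0.
  apply: pint_eqmod_add_mul; first exact: prime_gt0.
  by rewrite !rpredM ?rpredX ?rpred_nat ?pintegralV ?co.
rewrite sumrB sumr_const_nat subn0 -[_ *+ p]mulr_natl -!mulr_sumr -natr_sum bin2_sum.
have /dvdnP[k ->] : (p %| 'C(p, 2))%N.
  by apply: prime_dvd_bin => //; rewrite odd_prime_gt2.
rewrite natrM (_ : - _ = p%:R ^+ s.+1 * (- a%:R^-1 ^+ 2 * k%:R)); last by rewrite [p%:R ^+ s.+1]exprS; ring.
apply: pint_eqmod_add_mul; first exact: prime_gt0.
by rewrite rpredM ?rpredN ?rpredX ?rpred_nat ?pintegralV.
Qed.

Lemma sum_pinv_class (p s c : nat) : prime p -> odd p ->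
  pint_eqmod p s.+1 (\sum_(0 <= t < p ^ s) pinv p (t * p + c)) (p%:R ^+ s * pinv p c).
Proof.
move=> p_prime p_odd; elim: s => [|s IHs].
  by rewrite expn0 big_nat1 mul0n add0n expr0 mul1r; apply: pint_eqmod_ref.
(* Indices below p^(s+1) are v p^s + t; varying v moves the argument by multiples of p^(s+1), as in
   [sum_pinv_lift]. *)
rewrite expnS sum_nat_mul exchange_big_nat /=.
apply: (@pint_eqmod_trans _ _ (\sum_(0 <= t < p ^ s) p%:R * pinv p (t * p + c))).
  apply: pint_eqmod_sum_nat => t _.
  have := sum_pinv_lift p s.+1 (t * p + c) p_prime p_odd isT.
  congr pint_eqmod; apply: eq_bigr => v _; congr pinv.
  by rewrite expnS; lia.
rewrite -mulr_sumr exprS -mulrA -[X in X * _]expr1 -[X in _ (X * (_ * _))]expr1.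
by rewrite -[s.+2]add1n; apply: pint_eqmodMpX => //; apply: prime_gt0.
Qed.

Lemma sum_pinv_congr (p r c : nat) : prime p -> odd p -> (0 < r)%N ->
  pint_eqmod p r (\sum_(0 <= m < p ^ r) (if (c == m %[mod p])%N then pinv p m else 0))
             (p%:R ^+ r.-1 * pinv p (c %% p)).
Proof.
move=> p_prime p_odd r_gt0; have := sum_pinv_class p r.-1 (c %% p) p_prime p_odd.
have -> : (p ^ r = p ^ r.-1 * p)%N by rewrite -expnSr prednK.
rewrite prednK // sum_nat_mul.
congr pint_eqmod; apply: eq_bigr => t _.
(* Each block of p consecutive integers meets the class of c once, at offset [c %% p]. *)
rewrite -(sum_nat_delta p (c %% p) (fun j => pinv p (t * p + j))); last first.
  by rewrite ltn_mod prime_gt0.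
rewrite !big_nat; apply: eq_bigr => j /andP[_ jp].
by rewrite modnMDl [in RHS](modn_small jp).
Qed.

Lemma sum_sign_odd (n : nat) : odd n -> \sum_(0 <= t < n) (-1) ^+ t = 1 :> rat.
Proof.
move=> n_odd; have -> : n = n./2.*2.+1 by lia.
elim: n./2 => [|k IHk]; first by rewrite big_nat1.
rewrite doubleS 2?[\sum_(0 <= c < _.+2) _]big_nat_recr //= IHk.
by rewrite !exprS -signr_odd odd_double; ring.
Qed.

(** For i = tp + c the summand is, modulo p, (-1)^t times that of c, since p is odd; the N block
    signs add up to 1. *)
Lemma sum_sign_pinv_cube (p N : nat) : prime p -> odd p -> odd N ->
  pint_eqmod p 1
    (\sum_(0 <= i < N * p) (-1) ^+ i * pinv p i ^+ 2 * pinv p (i %% p))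
    (\sum_(0 <= c < p) (-1) ^+ c * pinv p c ^+ 3).
Proof.
move=> p_prime p_odd N_odd; rewrite sum_nat_mul.
rewrite -[X in pint_eqmod _ _ _ X]mul1r -[X in X * _](sum_sign_odd N) // mulr_suml.
apply: pint_eqmod_sum_nat => t _; rewrite mulr_sumr.
apply: pint_eqmod_sum_nat => c /andP[_ cp].
have -> : (-1) ^+ (t * p + c) = (-1) ^+ t * (-1) ^+ c :> rat.
  by rewrite exprD mulnC exprM -[(-1) ^+ p]signr_odd p_odd.
rewrite modnMDl modn_small //.
rewrite [X in pint_eqmod _ _ _ X](_ : _ = (-1) ^+ t * (-1) ^+ c * pinv p c ^+ 2 * pinv p c); last by ring.
apply: pint_eqmodMr; first exact: pinv_pintegral.
apply: pint_eqmodMl; first by rewrite rpredM // rpredX // rpredN rpred1.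
apply: pint_eqmodX; rewrite ?pinv_pintegral //.
by have := pinv_addM p 1 c t p_prime isT; rewrite expn1 mulnC addnC.
Qed.

(** * Reduction of the triple sum to pairs *)

(** Congruent pairs are dropped because m - i is j when m = i + j and k when m = q - j, and both
    must be coprime to p. *)
Definition pairTerm (p i m : nat) : rat :=
  if (i == m %[mod p])%N then 0 else (-1) ^+ i * pinv p i ^+ 2 * pinv p m.

(** Two signs cancel: (-1)^i changes sign because p^r is odd, and 1/m does so under reflection;
    1/i^2 is unchanged. *)
Lemma pairTerm_opp (p r i m : nat) : prime p -> odd p -> (0 < r)%N ->
  (i <= p ^ r)%N -> (m <= p ^ r)%N ->
  pint_eqmod p r (pairTerm p (p ^ r - i) (p ^ r - m)) (pairTerm p i m).
Proof.
move=> p_prime p_odd r_gt0 iq mq; rewrite /pairTerm.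
have pq : (p %| p ^ r)%N by rewrite dvdn_exp.
have -> : (p ^ r - i == p ^ r - m %[mod p])%N = (i == m %[mod p])%N.
  rewrite -(eqn_modDr (i + m)) addnA subnK // [(i + m)%N]addnC addnA subnK //.
  by rewrite !eqn_modDl eq_sym.
case: ifP => _; first exact: pint_eqmod_ref.
have -> : (-1) ^+ (p ^ r - i) = - (-1) ^+ i :> rat.
  by rewrite -signr_odd oddB // oddX p_odd orbT -[(-1) ^+ i]signr_odd; case: odd; rewrite ?opprK.
rewrite !mulNr -mulrN; apply: pint_eqmodM.
- by rewrite rpredM // rpredX ?rpredN ?rpred1 ?pinv_pintegral.
- exact: pinv_pintegral.
- apply: pint_eqmodMl; first by rewrite rpredX // rpredN rpred1.
  rewrite -[X in pint_eqmod _ _ _ X]sqrrN.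
  by apply: pint_eqmodX; rewrite ?rpredN ?pinv_pintegral //; apply: pinv_opp.
- rewrite -[X in pint_eqmod _ _ _ X]opprK; apply: pint_eqmodN; exact: pinv_opp.
Qed.

(* Partial fractions: 1/(j(i+j)) = (1/j - 1/(i+j))/i. *)
Lemma tripleTerm_split (p r i j : nat) : prime p -> (0 < r)%N ->
  (i + j <= p ^ r)%N ->
  pint_eqmod p r ((-1) ^+ i * pinv p i * pinv p j * pinv p (p ^ r - (i + j)))
     (pairTerm p i (i + j) + pairTerm p i (p ^ r - j)).
Proof.
move=> p_prime r_gt0 ijq.
have pq : (p %| p ^ r)%N by rewrite dvdn_exp.
have iq : (i <= p ^ r)%N by apply: leq_trans ijq; rewrite leq_addr.
have jq : (j <= p ^ r)%N by apply: leq_trans ijq; rewrite leq_addl.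
have Ps k : (-1) ^+ k \in pintegral p by rewrite rpredX // rpredN rpred1.
pose T : rat := (-1) ^+ i * pinv p i ^+ 2.
have PT : T \in pintegral p by rewrite rpredM // rpredX // pinv_pintegral.
have co n : coprime n p = ~~ (p %| n)%N by rewrite coprime_sym prime_coprime.
apply: (@pint_eqmod_trans _ _ ((-1) ^+ i * pinv p i * pinv p j * - pinv p (i + j))).
  by apply: pint_eqmodMl; [rewrite !rpredM ?pinv_pintegral | apply: pinv_opp].
(* After 1/k and 1/(q-j) are replaced by -1/(i+j) and -1/j, an exact identity remains; both sides
   are 0 if p divides i, j or i+j. *)
apply: (@pint_eqmod_trans _ _ (pairTerm p i (i + j) +
     (if (i == p ^ r - j %[mod p])%N then 0 else T * - pinv p j))); last first.
  apply: pint_eqmodD; first exact: pint_eqmod_ref.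
  rewrite /pairTerm; case: ifP => _; first exact: pint_eqmod_ref.
  by apply: pint_eqmodMl => //; apply: pint_eqmod_sym; apply: pinv_opp.
rewrite /pairTerm -/T.
have -> : (i == i + j %[mod p])%N = (p %| j)%N.
  by rewrite -{1}(addn0 i) eqn_modDl mod0n eq_sym.
have -> : (i == p ^ r - j %[mod p])%N = (p %| i + j)%N.
  by rewrite -(eqn_modDr j) subnK // (eqnP pq).
have [pi|pi] := boolP (p %| i)%N.
  have fi : pinv p i = 0 by rewrite /pinv co pi.
  rewrite /T fi expr0n /= !(mulr0, mul0r) !if_same addr0.
  exact: pint_eqmod_ref.
have [pj|pj] := boolP (p %| j)%N.
  rewrite /pinv (co j) pj oppr0 !(mulr0, mul0r) if_same addr0; exact: pint_eqmod_ref.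
have [pij|pij] := boolP (p %| i + j)%N.
  rewrite /pinv (co (i + j)%N) pij oppr0 !(mulr0, mul0r) addr0; exact: pint_eqmod_ref.
have n0 n : coprime n p -> n%:R != 0 :> rat.
  by move=> np; rewrite pnatr_eq0 -lt0n (prime_coprime_gt0 p).
rewrite /T /pinv !co pi pj pij.
rewrite [X in pint_eqmod _ _ X](_ : _ =
  (-1) ^+ i * i%:R^-1 ^+ 2 * (i + j)%:R^-1 + (-1) ^+ i * i%:R^-1 ^+ 2 * - j%:R^-1).
  exact: pint_eqmod_ref.
have := n0 (i + j)%N; rewrite co natrD => /(_ pij) ij0.
by field; rewrite ij0 !n0 // co.
Qed.

(* Each half of the split triple sum runs over the pairs i < m, and the
   reflection (i, m) -> (q - i, q - m) exchanges them with the pairs m < i. *)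
Lemma sum_tripleTerm (p r : nat) : prime p -> odd p -> (0 < r)%N ->
  pint_eqmod p r
   (\sum_(1 <= i < p ^ r) \sum_(1 <= j < p ^ r - i)
      (-1) ^+ i * pinv p i * pinv p j * pinv p (p ^ r - (i + j)))
   (\sum_(1 <= i < p ^ r) \sum_(1 <= m < p ^ r) pairTerm p i m).
Proof.
move=> p_prime p_odd r_gt0; set q := (p ^ r)%N.
pose U i := \sum_(1 <= j < q - i) pairTerm p i (i + j).
pose V i := \sum_(1 <= j < i) pairTerm p i j.
apply: (@pint_eqmod_trans _ _ (\sum_(1 <= i < q) (U i + U i))).
  apply: pint_eqmod_sum_nat => i /andP[i0 iq].
  (* The reflection j -> q - i - j identifies the two halves. *)
  have -> : U i + U i = \sum_(1 <= j < q - i) (pairTerm p i (i + j) + pairTerm p i (q - j)).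
    rewrite big_split /=; congr (_ + _); rewrite /U big_nat_rev /= !big_nat.
    by apply: eq_bigr => j /andP[j0 jq]; congr pairTerm; lia.
  apply: pint_eqmod_sum_nat => j /andP[j0 jq].
  by apply: tripleTerm_split => //; rewrite -/q; lia.
rewrite big_split /=.
apply: (@pint_eqmod_trans _ _ (\sum_(1 <= i < q) V i + \sum_(1 <= i < q) U i)).
  apply: pint_eqmodD; last exact: pint_eqmod_ref.
  rewrite big_nat_rev; apply: pint_eqmod_sum_nat => i /andP[i0 iq].
  rewrite add1n subSS /U subKn ?(ltnW iq) // big_nat_rev.
  apply: pint_eqmod_sum_nat => j /andP[j0 ji]; rewrite add1n subSS.
  rewrite (_ : (q - i + (i - j) = q - j)%N); last by lia.
  by apply: pairTerm_opp => //; rewrite -/q; lia.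
rewrite -big_split /= (_ : \sum_(1 <= i < q) (V i + U i) =
  \sum_(1 <= i < q) \sum_(1 <= m < q) pairTerm p i m); first exact: pint_eqmod_ref.
rewrite !big_nat; apply: eq_bigr => i /andP[i0 iq].
rewrite (@big_cat_nat _ _ _ i 1 q) ?(ltnW iq) //=; congr (_ + _).
(* The diagonal term m = i is 0, so m < i and m > i make up the whole range. *)
rewrite big_ltn // {1}/pairTerm eqxx add0r /U -[i.+1]add1n big_addn.
by apply: eq_bigr => j _; rewrite addnC.
Qed.

(** For fixed i, the sum over all m vanishes modulo p^r, leaving minus the class of i, of sum
    p^(r-1)/(i mod p). With that factor in front, the sum over i matters only modulo p. *)
Lemma sum_pairTerm (p r : nat) : prime p -> odd p -> (0 < r)%N ->
  pint_eqmod p r (\sum_(1 <= i < p ^ r) \sum_(1 <= m < p ^ r) pairTerm p i m)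
    (- (p%:R ^+ r.-1 * \sum_(0 <= c < p) (-1) ^+ c * pinv p c ^+ 3)).
Proof.
move=> p_prime p_odd r_gt0; set q := (p ^ r)%N.
have q_gt0 : (0 < q)%N by rewrite expn_gt0 prime_gt0.
have Ps k : (-1) ^+ k * pinv p k ^+ 2 \in pintegral p.
  by rewrite rpredM // rpredX ?rpredN ?rpred1 ?pinv_pintegral.
apply: (@pint_eqmod_trans _ _ (- (p%:R ^+ r.-1 *
   \sum_(0 <= i < q) (-1) ^+ i * pinv p i ^+ 2 * pinv p (i %% p)))); last first.
  apply: pint_eqmodN.
  have -> : q = (p ^ r.-1 * p)%N by rewrite -expnSr prednK.
  rewrite -{1}(prednK r_gt0) -addn1; apply: pint_eqmodMpX; first exact: prime_gt0.
  by apply: sum_sign_pinv_cube => //; rewrite oddX p_odd orbT.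
rewrite [X in - (_ * X)]big_ltn // pinv0 expr0n /= mulr0 mul0r add0r mulr_sumr -sumrN.
apply: pint_eqmod_sum_nat => i _.
have -> : \sum_(1 <= m < q) pairTerm p i m = (-1) ^+ i * pinv p i ^+ 2 *
   (\sum_(1 <= m < q) pinv p m ^+ 1
    - \sum_(0 <= m < q) (if (i == m %[mod p])%N then pinv p m else 0)).
  rewrite [X in _ - X]big_ltn // pinv0 if_same add0r -sumrB mulr_sumr.
  by apply: eq_bigr => m _; rewrite /pairTerm; case: ifP => _; rewrite expr1; ring.
rewrite [X in pint_eqmod _ _ _ X](_ : _ = (-1) ^+ i * pinv p i ^+ 2 *
  (0 - p%:R ^+ r.-1 * pinv p (i %% p))); last by ring.
apply: pint_eqmodMl => //; apply: pint_eqmodB; first exact: sum_pinv_odd.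
exact: sum_pinv_congr.
Qed.

(** * Elimination of k and conclusion *)

(** The index k is forced to be q - i - j. Boundary terms vanish: [pinv] is 0 at 0, and also at q
    because p divides q. *)
Lemma sum_triples (p q : nat) : prime p -> (0 < q)%N -> (p %| q)%N ->
  \sum_(i < q.+1) \sum_(j < q.+1)
     \sum_(k < q.+1 | [&& (i + j + k == q)%N, posCoprime p i,
                          posCoprime p j & posCoprime p k])
       (-1) ^+ i / (i * j * k)%N%:R
  = \sum_(1 <= i < q) \sum_(1 <= j < q - i)
      (-1) ^+ i * pinv p i * pinv p j * pinv p (q - (i + j)) :> rat.
Proof.
move=> p_prime q_gt0 pq.
pose G i j : rat := if (i + j <= q)%N then
  (-1) ^+ i * pinv p i * pinv p j * pinv p (q - (i + j)) else 0.
have posE n : posCoprime p n = coprime n p.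
  by rewrite /posCoprime; apply: andb_idl; apply: prime_coprime_gt0.
transitivity (\sum_(0 <= i < q.+1) \sum_(0 <= j < q.+1) G i j).
  rewrite big_mkord; apply: eq_bigr => i _; rewrite big_mkord; apply: eq_bigr => j _.
  rewrite /G; case: leqP => [ijq|ijq]; last first.
    by rewrite big_pred0 // => k; apply/negbTE; apply/negP => /andP[/eqP]; lia.
  have kq : (q - (i + j) < q.+1)%N by rewrite ltnS leq_subr.
  rewrite (big_mkcondr) /= (big_pred1 (Ordinal kq)) /=; last first.
    by move=> k; rewrite /= -val_eqE /=; apply/eqP/eqP; lia.
  rewrite !posE /pinv.
  case: (coprime i p); case: (coprime j p); case: (coprime _ p);
    by rewrite /= ?(mulr0, mul0r) // !natrM !invfM !mulrA.
rewrite big_ltn // big1 ?add0r => [|j _]; last by rewrite /G pinv0 !(mulr0, mul0r) if_same.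
have pq0 : pinv p q = 0 by rewrite /pinv coprime_sym prime_coprime // pq.
rewrite big_nat_recr //= [X in _ + X]big1 ?addr0 => [|j _]; last first.
  by rewrite /G pq0 !(mulr0, mul0r) if_same.
rewrite !big_nat; apply: eq_bigr => i /andP[i0 iq].
rewrite big_ltn // {1}/G pinv0 !(mulr0, mul0r) if_same add0r.
rewrite (@big_cat_nat _ _ _ (q - i)) /=; [|lia|lia].
rewrite [X in _ + X]big_nat [X in _ + X]big1 ?addr0 => [|j /andP[j0 jq]].
  by rewrite !big_nat; apply: eq_bigr => j /andP[j0 jq]; rewrite /G ifT //; lia.
rewrite /G; case: leqP => // ijq.
by rewrite (_ : q - (i + j) = 0)%N ?pinv0 ?mulr0 //; lia.
Qed.

Theorem theorem2 (p r : nat) (p_prime : prime p) (p_odd : odd p)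
    (r_gt0 : (0 < r)%N) :
  pint_eqmod p r
    (\sum_(i < (p ^ r).+1) \sum_(j < (p ^ r).+1)
       \sum_(k < (p ^ r).+1 | [&& (i + j + k == p ^ r)%N, posCoprime p i,
                                  posCoprime p j & posCoprime p k])
         (-1) ^+ i / (i * j * k)%N%:R)
    (1 / 2%:R * (p ^ r.-1)%N%:R * bernoulli (p - 3)).
Proof.
rewrite sum_triples ?dvdn_exp ?expn_gt0 ?(prime_gt0 p_prime) //.
apply: (pint_eqmod_trans _ _ _ _ _ (sum_tripleTerm p r p_prime p_odd r_gt0)).
apply: (pint_eqmod_trans _ _ _ _ _ (sum_pairTerm p r p_prime p_odd r_gt0)).
rewrite natrX (_ : 1 / 2%:R * _ * _ =
  - (p%:R ^+ r.-1 * (- (1 / 2) * bernoulli (p - 3)))); last by field.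
apply: pint_eqmodN; rewrite -{1}(prednK r_gt0) -addn1.
apply: pint_eqmodMpX; first exact: prime_gt0.
exact: sum_alternating_pinv_cube.
Qed.
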